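(* For a sofic shift $X$, the generalised left Fischer cover of $X$ and the left Krieger cover of $X$ are both foundations of the past set cover of $X$.
   Context: A shift space over a finite alphabet $\mathcal{A}$ is a closed shift-invariant subset $X\subseteq\mathcal{A}^{\mathbb{Z}}$; $\mathcal{B}(X)$ is its language (finite factors of elements), $X^-$ and $X^+$ are the sets of left-rays $\cdots x_{-2}x_{-1}$ and right-rays $x_0x_1\cdots$ of its elements. For $x\in X^+$ (right-ray) or $x\in\mathcal{B}(X)$ (word), $P_\infty(x)$ is the set of left-rays which may precede $x$ in $X$. A labelled graph is a directed graph with a labelling of its edges; it presents the shift of label sequences of biinfinite paths, and a shift space is sofic if presented by a finite labelled graph. A labelled graph is left-resolving if no vertex receives two edges with the same label, and predecessor-separated if distinct vertices have distinct sets of labels of left-infinite paths terminating at them. Left Krieger cover: the labelled graph $(K,\mathcal{L}_K)$ with $K^0=\{P_\infty(x^+)\mid x^+\in X^+\}$ and an edge labelled $a$ from $P$ to $P'$ iff there is $x^+\in X^+$ with $P=P_\infty(ax^+)$, $P'=P_\infty(x^+)$. Past set cover: the labelled graph with vertex set $\{P_\infty(w)\mid w\in\mathcal{B}(X)\}$ and an edge labelled $a$ from $P$ to $P'$ iff there is $w\in\mathcal{B}(X)$ with $P=P_\infty(aw)$, $P'=P_\infty(w)$ (where $aw\in\mathcal{B}(X)$). Generalised left Fischer cover: $P\in K^0$ is indecomposable if $V\subseteq K^0$, $P=\bigcup_{Q\in V}Q$ imply $P\in V$. Write $P\ge P'$ if there is a (possibly trivial) path in $K$ from $P$ to $P'$.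 The generalised left Fischer cover is the labelled subgraph of $(K,\mathcal{L}_K)$ induced by $\{P\in K^0\mid P\ge P'\text{ for some indecomposable }P'\in K^0\}$. Foundations: let $\mathcal{E}=(E,\mathcal{L})$ be a finite left-resolving and predecessor-separated labelled graph over $\mathcal{A}$. For $V\subseteq E^0$ and a word $w$, let $wV$ be the set of sources of paths labelled $w$ terminating in $V$. Let $S$ be a subset of the power set of $E^0$ and $\sim$ an equivalence relation on $S$. The pair $(S,\sim)$ is past closed if for all $u,v\in E^0$, $U,V\in S$, $a\in\mathcal{A}$: $\{v\}\in S$; $\{u\}\sim\{v\}$ implies $u=v$; $aV\neq\emptyset$ implies $aV\in S$; $U\sim V$ and $aU\neq\emptyset$ imply $aV\ne\emptyset$ and $aU\sim aV$. For $(S,\sim)$ past closed, $\mathcal{G}(\mathcal{E},S,\sim)$ is the labelled graph with vertex set $S/{\sim}$ and an edge labelled $a$ from $[aV]$ to $[V]$ whenever $aV\neq\emptyset$. $\mathcal{E}$ is a foundation of a labelled graph $\mathcal{H}$ if $\mathcal{H}$ is isomorphic, as a labelled graph, to $\mathcal{G}(\mathcal{E},S,\sim)$ for some past closed pair $(S,\sim)$. *)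

(* Defs.v *)
From HB Require Import structures.
From mathcomp Require Import all_boot all_order all_algebra.
From mathcomp Require Import all_classical.
From mathcomp Require Import topology.

Set Implicit Arguments.
Unset Strict Implicit.
Unset Printing Implicit Defensive.

Local Open Scope classical_set_scope.
Local Open Scope ring_scope.

(* A left-ray [... x_(-2) x_(-1)] is encoded as [n |-> x_(-n-1)] and a
   right-ray [x_0 x_1 ...] as [n |-> x_n]; both have type [nat -> A]. *)

Section Shift.
Variable A : finType.

Definition shift_map (x : int -> A) : int -> A := fun i => x (i + 1).

Definition shift_space (X : set (int -> A)) : Prop :=
  @closed (prod_topology (fun _ : int => discrete_topology A)) X /\
  shift_map @` X = X.

Definition language (X : set (int -> A)) : set (seq A) :=
  [set w | exists2 x, X x &
     exists i : int, w = mkseq (fun k => x (i + k%:Z)) (size w)].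

(* The point [... y_1 y_0 . z_0 z_1 ...]; recall [Negz n = - (n + 1)]. *)
Definition join_rays (y z : nat -> A) : int -> A :=
  fun i => match i with Posz n => z n | Negz n => y n end.

Definition ray_cons (a : A) (z : nat -> A) : nat -> A :=
  fun n => if n is m.+1 then z m else a.

Definition ray_cat (w : seq A) (z : nat -> A) : nat -> A :=
  foldr ray_cons z w.

Definition right_rays (X : set (int -> A)) : set (nat -> A) :=
  [set z | exists y, X (join_rays y z)].

Definition pred_ray (X : set (int -> A)) (z : nat -> A) : set (nat -> A) :=
  [set y | X (join_rays y z)].

Definition pred_word (X : set (int -> A)) (w : seq A) : set (nat -> A) :=
  [set y | exists z, X (join_rays y (ray_cat w z))].

End Shift.

Record lgraph (A : Type) := LGraph {
  vertex : Type;
  edge : Type;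
  src : edge -> vertex;
  tgt : edge -> vertex;
  lab : edge -> A }.

Section Graph.
Variable A : Type.

Definition finite_lgraph (G : lgraph A) : Prop :=
  finite_set [set: vertex G] /\ finite_set [set: edge G].

Definition lgraph_iso (G H : lgraph A) : Prop :=
  exists (f : vertex G -> vertex H) (g : edge G -> edge H),
    [/\ bijective f, bijective g,
        forall e, src (g e) = f (src e),
        forall e, tgt (g e) = f (tgt e) &
        forall e, lab (g e) = lab e].

Fixpoint is_path (G : lgraph A) (u : vertex G) (p : seq (edge G))
    (v : vertex G) : Prop :=
  if p is e :: p' then src e = u /\ is_path (tgt e) p' v else u = v.

Definition presented_shift (G : lgraph A) : set (int -> A) :=
  [set x | exists p : int -> edge G,
     forall i, tgt (p i) = src (p (i + 1)) /\ lab (p i) = x i].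

(* The left-ray [y] labels a left-infinite path ending at [v]; as for rays,
   [p n] is the edge at position [- n - 1]. *)
Definition graph_pred (G : lgraph A) (v : vertex G) : set (nat -> A) :=
  [set y | exists p : nat -> edge G,
     tgt (p 0%N) = v /\
     forall n, tgt (p n.+1) = src (p n) /\ lab (p n) = y n].

Definition left_resolving (G : lgraph A) : Prop :=
  forall e e' : edge G, tgt e = tgt e' -> lab e = lab e' -> e = e'.

Definition predecessor_separated (G : lgraph A) : Prop :=
  forall u v : vertex G, u <> v -> graph_pred u <> graph_pred v.

Definition induced_lgraph (G : lgraph A) (D : set (vertex G)) : lgraph A :=
  let E := [set e : edge G | D (src e) /\ D (tgt e)] in
  @LGraph A D E
    (fun e => SigSub (mem_set (proj1 (set_mem (valP e)))))
    (fun e => SigSub (mem_set (proj2 (set_mem (valP e)))))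
    (fun e => lab (val e)).

Definition rel_lgraph (T : Type) (Q : set T) (R : T -> A -> T -> Prop) :
    lgraph A :=
  let E := [set e : Q * A * Q | R (val e.1.1) e.1.2 (val e.2)] in
  @LGraph A Q E (fun e => (val e).1.1) (fun e => (val e).2)
    (fun e => (val e).1.2).

Definition word_pre (G : lgraph A) (w : seq A) (V : set (vertex G)) :
    set (vertex G) :=
  [set u | exists p v, [/\ is_path u p v, map (@lab A G) p = w & V v]].

Definition equivalence_on (T : Type) (S : set T) (R : T -> T -> Prop) : Prop :=
  [/\ forall U, S U -> R U U,
      forall U V, S U -> S V -> R U V -> R V U &
      forall U V W, S U -> S V -> S W -> R U V -> R V W -> R U W].

Definition eq_class (T : Type) (S : set T) (R : T -> T -> Prop) (U : T) :
    set T :=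
  [set W | S W /\ R U W].

(* Only the restriction of [R] to [S] is relevant. *)
Definition past_closed (G : lgraph A) (S : set (set (vertex G)))
    (R : set (vertex G) -> set (vertex G) -> Prop) : Prop :=
  equivalence_on S R /\
  [/\ forall v : vertex G, S [set v],
      forall u v : vertex G, R [set u] [set v] -> u = v,
      forall V a, S V -> word_pre [:: a] V !=set0 -> S (word_pre [:: a] V) &
      forall U V a, S U -> S V -> R U V -> word_pre [:: a] U !=set0 ->
        word_pre [:: a] V !=set0 /\ R (word_pre [:: a] U) (word_pre [:: a] V)].

Definition past_lgraph (G : lgraph A) (S : set (set (vertex G)))
    (R : set (vertex G) -> set (vertex G) -> Prop) : lgraph A :=
  rel_lgraph [set eq_class S R V | V in S]
    (fun C a C' => exists V, [/\ S V, word_pre [:: a] V !=set0,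
       C = eq_class S R (word_pre [:: a] V) & C' = eq_class S R V]).

Definition foundation (G H : lgraph A) : Prop :=
  [/\ finite_lgraph G, left_resolving G, predecessor_separated G &
      exists (S : set (set (vertex G)))
        (R : set (vertex G) -> set (vertex G) -> Prop),
        past_closed S R /\ lgraph_iso H (past_lgraph S R)].

End Graph.

Section Covers.
Variable A : finType.

Definition sofic (X : set (int -> A)) : Prop :=
  shift_space X /\
  exists G : lgraph A, finite_lgraph G /\ presented_shift G = X.

Definition krieger_vertices (X : set (int -> A)) : set (set (nat -> A)) :=
  [set pred_ray X z | z in right_rays X].

Definition left_krieger_cover (X : set (int -> A)) : lgraph A :=
  rel_lgraph (krieger_vertices X)
    (fun P a P' => exists z, [/\ right_rays X z,
       P = pred_ray X (ray_cons a z) & P' = pred_ray X z]).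

Definition past_set_cover (X : set (int -> A)) : lgraph A :=
  rel_lgraph [set pred_word X w | w in language X]
    (fun P a P' => exists w, [/\ language X w, language X (a :: w),
       P = pred_word X (a :: w) & P' = pred_word X w]).

Definition indecomposable (X : set (int -> A)) (P : krieger_vertices X) :
    Prop :=
  forall V : set (set (nat -> A)), V `<=` krieger_vertices X ->
    val P = \bigcup_(Q in V) Q -> V (val P).

Definition generalised_left_fischer_cover (X : set (int -> A)) : lgraph A :=
  induced_lgraph
    [set P : vertex (left_krieger_cover X) |
       exists2 P' : vertex (left_krieger_cover X),
         indecomposable P' & exists p, is_path P p P'].

End Covers.

(* Main.v *)
(* By shift invariance P_oo(a z) = {y | y a is in P_oo(z)}, so the Krieger cover
   is left-resolving; by compactness the left-rays that label paths ending at a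
   vertex P are the elements of P, so it is predecessor-separated.  Since a sofic
   shift has finitely many past sets, compactness also gives P_oo(z) = P_oo(w)
   for a long enough prefix w of z, while P_oo(w) is the union of the P_oo(w z).
   So the sets V of vertices whose union is some P_oo(w), two of them being
   equivalent when they have the same union, form a past closed pair which yields
   the past set cover.  The argument only uses that the vertices of the graph
   generate all the P_oo(w) under unions and are closed under predecessors in the
   Krieger cover; this also holds for the generalised Fischer cover, because by
   finiteness each vertex of the Krieger cover is a union of indecomposable
   ones. *)

Require Import Defs.
From mathcomp Require Import all_boot all_order all_algebra.
From mathcomp Require Import finmap.
From mathcomp Require Import all_classical.
From mathcomp Require Import topology.

Set Implicit Arguments.
Unset Strict Implicit.
Unset Printing Implicit Defensive.
Set SsrOldRewriteGoalsOrder.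

Import GRing.Theory.
Local Open Scope classical_set_scope.
Local Open Scope ring_scope.

(** * Finite families of sets *)

Lemma finite_set_unions (T : Type) (F : set (set T)) : finite_set F ->
  finite_set [set \bigcup_(Q in V) Q | V in [set V | V `<=` F]].
Proof.
move=> /finite_seqP[s ->].
(* A union is coded by the indices of its members in an enumeration of [F]. *)
pose g (m : {ffun 'I_(size s) -> bool}) :=
  [set t | exists2 i, m i & nth set0 s i t].
apply: (@sub_finite_set _ _ (g @` setT)); last exact: finite_image.
move=> _ [V VF <-]; exists [ffun i : 'I__ => `[< V (nth set0 s i) >]] => //.
apply/seteqP; split=> t /=.
  by move=> [i]; rewrite ffunE => /asboolP ? ?; exists (nth set0 s i).
move=> [Q VQ Qt]; have Qs := VF _ VQ.
have ltQ : (index Q s < size s)%N by rewrite index_mem.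
by exists (Ordinal ltQ); rewrite ?ffunE /= nth_index//; apply/asboolP.
Qed.

(** Passing from [P] to a proper subset [Q] loses at least [P] among the members of [F] included in
    it, so their number decreases. *)
Lemma finite_set_proper_ind (T : Type) (F : set (set T)) (K : set T -> Prop) :
    finite_set F ->
    (forall P, F P -> (forall Q, F Q -> Q `<` P -> K Q) -> K P) ->
  forall P, F P -> K P.
Proof.
move=> finF step.
pose m P := fset_set [set Q | F Q /\ Q `<=` P].
have finm P : finite_set [set Q | F Q /\ Q `<=` P].
  by apply: sub_finite_set finF => Q [].
have mP P Q : (Q \in m P) = `[< F Q /\ Q `<=` P >].
  by rewrite in_fset_set//; apply/idP/asboolP; rewrite inE.
suff H n P : F P -> (#|` m P| < n)%N -> K P by move=> P FP; apply: (H _ P FP).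
elim: n P => // n IHn P FP; rewrite ltnS => lePn.
apply: step => // Q FQ [QP PQ].
apply: IHn => //; apply: leq_trans lePn; apply: fproper_ltn_card.
rewrite fproperE; apply/andP; split.
  apply/fsubsetP => R; rewrite !mP => /asboolP[FR RQ].
  by apply/asboolP; split=> //; exact: subset_trans RQ QP.
apply/fsubsetPn; exists P; first by rewrite mP; apply/asboolP; split.
by rewrite mP; apply/asboolP => -[].
Qed.

(** Induction on the value [P n]: either it persists from [n] on, or some later value is strictly
    smaller. *)
Lemma finite_decreasing_stationary (T : Type) (F : set (set T))
    (P : nat -> set T) :
    finite_set F -> (forall n, F (P n)) ->
    {homo P : m n / (m <= n)%N >-> n `<=` m} ->
  exists N, forall n, (N <= n)%N -> P n = P N.
Proof.
move=> finF FP decP.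
pose K Q := forall n, P n = Q -> exists N, forall n, (N <= n)%N -> P n = P N.
suff H : forall Q, F Q -> K Q by exact: (H _ (FP 0%N) 0%N).
apply: finite_set_proper_ind finF _ => Q _ IH n eQ; subst Q.
have [H|] := pselect (forall k, (n <= k)%N -> P k = P n); first by exists n.
move=> /existsNP[k /not_implyP[nk Pkn]].
apply: (IH _ (FP k) _ k) => //; split; first exact: decP.
by move=> Pnk; apply: Pkn; apply/seteqP; split=> //; apply: decP.
Qed.

(** * Biinfinite sequences, rays and shift-invariance *)

Lemma Posz_addr1 n : Posz n + 1 = Posz n.+1.
Proof. by rewrite -addn1. Qed.

Lemma NegzS_addr1 n : Negz n.+1 + 1 = Negz n.
Proof. by rewrite !NegzE -[n.+2]addn1 PoszD opprD addrNK. Qed.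

Section Rays.
Variable A : finType.
Implicit Types (X : set (int -> A)) (x : int -> A) (y z : nat -> A).
Implicit Types (w : seq A) (P : set (nat -> A)).

(* For a left-ray [y], [ray_cons a y] is the left-ray [... y_1 y_0 a]. *)
Definition ray_pre (a : A) (P : set (nat -> A)) : set (nat -> A) :=
  [set y | P (ray_cons a y)].

Lemma ray_pre_bigcup (I : Type) (D : set I) (F : I -> set (nat -> A)) a :
  ray_pre a (\bigcup_(i in D) F i) = \bigcup_(i in D) ray_pre a (F i).
Proof. by []. Qed.

Lemma shift_inj : injective (@shift_map A).
Proof.
move=> x x' e; apply/funext => i; rewrite -(subrK 1 i).
exact: (congr1 (@^~ _) e).
Qed.

Lemma shift_mapE X x : @shift_map A @` X = X -> X (shift_map x) = X x.
Proof.
move=> sX; apply/propext; split=> Xx; last by rewrite -sX; exists x.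
by move: Xx; rewrite -{1}sX => -[x' Xx' /shift_inj <-].
Qed.

Lemma shift_join_rays a y z :
  shift_map (join_rays y (ray_cons a z)) = join_rays (ray_cons a y) z.
Proof.
apply/funext; rewrite /shift_map => -[n|[|n]].
- by rewrite Posz_addr1.
- by [].
- by rewrite NegzS_addr1.
Qed.

Lemma pred_ray_cons X a z : @shift_map A @` X = X ->
  pred_ray X (ray_cons a z) = ray_pre a (pred_ray X z).
Proof.
move=> sX; apply/seteqP; split=> y /=;
  by rewrite /pred_ray /ray_pre /= -shift_join_rays shift_mapE.
Qed.

Lemma pred_word_bigcup X w :
  pred_word X w = \bigcup_z pred_ray X (ray_cat w z).
Proof.
by apply/seteqP; split=> y [z]; [exists z|move=> _; exists z].
Qed.

Lemma pred_word_cons X a w : @shift_map A @` X = X ->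
  pred_word X (a :: w) = ray_pre a (pred_word X w).
Proof.
move=> sX; rewrite !pred_word_bigcup ray_pre_bigcup.
by apply: eq_bigcupr => z _; rewrite -pred_ray_cons.
Qed.

Lemma translate_mem X x (i : int) : @shift_map A @` X = X ->
  X x -> X (fun j => x (j + i)).
Proof.
move=> sX Xx.
have pos m x' : X x' = X (fun j => x' (j + m%:Z)).
  elim: m => [|m ->]; first by congr X; apply/funext => j; rewrite addr0.
  rewrite -shift_mapE//; congr X; apply/funext => j.
  by rewrite /shift_map -addrA -PoszD add1n.
case: i => m; first by rewrite -pos.
rewrite (pos m.+1); rewrite (_ : (fun _ => _) = x)//.
by apply/funext => j; rewrite NegzE addrK.
Qed.

Lemma ray_catE a w z k :
  ray_cat w z k = if (k < size w)%N then nth a w k else z (k - size w)%N.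
Proof. by elim: w k => [|b w IHw] [|k] //=; rewrite ?subn0// IHw. Qed.

Lemma ray_cat_mkseq y z n k : (k < n)%N -> ray_cat (mkseq y n) z k = y k.
Proof.
by move=> kn; rewrite (ray_catE (y 0%N)) size_mkseq kn nth_mkseq.
Qed.

Lemma ray_cat_mkseqS y z n :
  ray_cat (mkseq y n.+1) z = ray_cat (mkseq y n) (ray_cons (y n) z).
Proof. by rewrite -addn1 /mkseq iotaD map_cat /ray_cat foldr_cat. Qed.

Lemma ray_cat_mkseq_drop z m : ray_cat (mkseq z m) (fun k => z (m + k)%N) = z.
Proof.
apply/funext => k; rewrite (ray_catE (z 0%N)) size_mkseq.
by case: ltnP => km; rewrite ?nth_mkseq ?subnKC.
Qed.

(** Translation moves an occurrence of [w] to position 0. Nonempty pasts will thus certify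
    membership in the language. *)
Lemma languageP X w : @shift_map A @` X = X ->
  language X w <-> pred_word X w !=set0.
Proof.
move=> sX; split=> [[x Xx [i ->]]|[y [z Xyz]]].
  pose x' j := x (j + i); have Xx' : X x' by exact: (translate_mem i sX Xx).
  exists (fun n => x' (Negz n)), (fun n => x' (size w + n)%N).
  rewrite (_ : mkseq _ _ = mkseq (fun n => x' n) (size w)); last first.
    by apply: eq_mkseq => k; rewrite /x' addrC.
  rewrite ray_cat_mkseq_drop.
  by rewrite (_ : join_rays _ _ = x')//; apply/funext => -[].
exists (join_rays y (ray_cat w z)) => //; exists 0.
(* A nonempty word supplies the default letter that [nth] needs. *)
case: w {Xyz} => // a w.
apply: (@eq_from_nth _ a); rewrite ?size_mkseq// => k kw.
by rewrite nth_mkseq// add0r /join_rays (ray_catE a) kw.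
Qed.

(** Points that agree with [x] from [- n] to [n - 1] converge to [x] in the product topology. *)
Lemma closed_pointwise X x :
    @closed (prod_topology (fun _ : int => discrete_topology A)) X ->
    (forall n, exists x', X x' /\ forall k, (k < n)%N ->
       x' (Posz k) = x k /\ x' (Negz k) = x (Negz k)) ->
  X x.
Proof.
move=> cX /choice[u uP].
pose T := prod_topology (fun _ : int => discrete_topology A).
apply: (@closed_cvg nat T \oo _ u X cX).
  by apply: nearW => n; case: (uP n).
apply/cvg_sup => i B [_ [[C _ <-] Cx CB]].
(* [Negz k] is position [- k - 1], so windows of size at least [N.+1] contain [i]. *)
pose N := if i is Posz k then k else if i is Negz k then k else 0%N.
exists N.+1 => // n /= Nn; apply: CB; rewrite /= (_ : u n i = x i)//.
have [_ uE] := uP n; rewrite /N in Nn.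
by case: i Nn {Cx C N} => k kn; have [] := uE k kn.
Qed.

End Rays.

(** * Past sets of rays and words *)

Section Pasts.
Variables (A : finType) (X : set (int -> A)).
Implicit Types (y z : nat -> A) (w : seq A).

(** Left-rays are stored backwards: [ray_cat (mkseq y n) y'] is [y'] followed by the last [n]
    letters of [y]. Closedness allows [n] to grow. *)
Lemma pred_ray_limit y z : shift_space X ->
    (forall n, exists y', pred_ray X z (ray_cat (mkseq y n) y')) ->
  pred_ray X z y.
Proof.
move=> [cX _] Hy; apply: closed_pointwise cX _ => n.
have [y' Xy'] := Hy n; exists (join_rays (ray_cat (mkseq y n) y') z).
by split=> // k kn; rewrite /= ray_cat_mkseq.
Qed.

(** If [y] precedes every prefix of [z], the witnessing points converge to [join_rays y z]. *)
Lemma pred_ray_bigcap z : shift_space X ->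
  pred_ray X z = \bigcap_n pred_word X (mkseq z n).
Proof.
move=> [cX _]; apply/seteqP; split=> y Xy.
  by move=> n _; exists (fun k => z (n + k)%N); rewrite ray_cat_mkseq_drop.
apply: closed_pointwise cX _ => n; have [z' Xyz'] := Xy n I.
exists (join_rays y (ray_cat (mkseq z n) z')).
by split=> // k kn; rewrite /= ray_cat_mkseq.
Qed.

Lemma pred_word_cat w w' : pred_word X (w ++ w') `<=` pred_word X w.
Proof.
by move=> y [z]; rewrite /ray_cat foldr_cat => ?; exists (ray_cat w' z).
Qed.

Lemma pred_word_krieger w : pred_word X w =
  \bigcup_(P in [set P | krieger_vertices X P /\ P `<=` pred_word X w]) P.
Proof.
apply/seteqP; split=> [y [z Xyz]|y [P [_ PX] Py]]; last exact: PX.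
exists (pred_ray X (ray_cat w z)) => //; split; last by move=> y' ?; exists z.
by exists (ray_cat w z) => //; exists y.
Qed.

Lemma krieger_vertices_neq0 P : krieger_vertices X P -> P !=set0.
Proof. by move=> [z [y Xyz] <-]; exists y. Qed.

(** The past of [z] is the union of [graph_pred v] over the vertices [v] where a path labelled [z]
    starts, and there are finitely many sets of vertices. *)
Lemma finite_krieger_vertices : sofic X -> finite_set (krieger_vertices X).
Proof.
move=> [_ [G [[finV _] GX]]].
apply: sub_finite_set (finite_set_unions (finite_image (@graph_pred A G) finV)).
move=> _ [z _ <-].
pose follower (v : vertex G) := exists q : nat -> edge G,
  src (q 0%N) = v /\ forall n, tgt (q n) = src (q n.+1) /\ lab (q n) = z n.
exists (@graph_pred A G @` follower); first by move=> _ [v _ <-]; exists v.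
rewrite bigcup_image; apply/seteqP; split=> y.
  move=> [v [q [q0 qP]] [p [p0 pP]]]; rewrite /pred_ray /= -GX.
  exists (fun i => match i with Posz n => q n | Negz n => p n end) => -[n|[|n]].
  - by rewrite Posz_addr1.
  - by have [_ ->] := pP 0%N; rewrite (_ : Negz 0 + 1 = 0) // p0 q0.
  - by rewrite NegzS_addr1; split; [have [] := pP n|have [] := pP n.+1].
rewrite /pred_ray /= -GX => -[p pP].
exists (src (p 0)).
  exists (fun n => p (Posz n)); split=> // n.
  by have [-> ->] := pP (Posz n); rewrite Posz_addr1.
exists (fun n => p (Negz n)); split=> [|n]; first by have [->] := pP (Negz 0).
have [-> _] := pP (Negz n.+1); have [_ ->] := pP (Negz n).
by rewrite NegzS_addr1.
Qed.

Lemma finite_pred_words : sofic X -> finite_set (range (pred_word X)).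
Proof.
move=> sX; have finK := finite_krieger_vertices sX.
apply: sub_finite_set (finite_set_unions finK).
move=> _ [w _ <-]; rewrite pred_word_krieger.
by exists [set P | krieger_vertices X P /\ P `<=` pred_word X w] => // P [].
Qed.

(** The pasts of the prefixes of [z] decrease within a finite family, so their intersection is one
    of them. This is what puts singletons in [S] below. *)
Lemma krieger_pred_word P : sofic X -> krieger_vertices X P ->
  exists2 w, language X w & P = pred_word X w.
Proof.
move=> sX KP; have [shX _] := sX; have [_ invX] := shX.
have := KP => -[z _ Pz].
have decP : {homo (fun n => pred_word X (mkseq z n)) :
    m n / (m <= n)%N >-> n `<=` m}.
  move=> m n /subnKC <-; rewrite /mkseq iotaD map_cat.
  exact: pred_word_cat.
have [|N NP] := finite_decreasing_stationary (finite_pred_words sX) _ decP.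
  by move=> n; exists (mkseq z n).
have PE : P = pred_word X (mkseq z N).
  rewrite -Pz pred_ray_bigcap//; apply/seteqP; split=> y Hy; first exact: Hy.
  move=> n _; have [nN|/ltnW nN] := leqP N n; first by rewrite NP.
  exact: (decP _ _ nN).
by exists (mkseq z N) => //; apply/(languageP _ invX); rewrite -PE;
  apply: krieger_vertices_neq0.
Qed.

End Pasts.

(** * Labelled graphs and their isomorphisms *)

Section Graphs.
Variable A : Type.
Implicit Types G H : lgraph A.

Lemma word_pre1 G a (V : set (vertex G)) (u : vertex G) :
  word_pre [:: a] V u <->
  exists e : edge G, [/\ src e = u, lab e = a & V (tgt e)].
Proof.
split=> [[[|e [|e' p]] [v []]]//= [<- <-] [<-] Vv|[e [<- <- Ve]]].
  by exists e.
by exists [:: e], (tgt e); split.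
Qed.

Definition simple_lgraph G := forall e e' : edge G,
  src e = src e' -> lab e = lab e' -> tgt e = tgt e' -> e = e'.

(** The edge map is obtained by choice; simplicity of [G] makes it injective, that of [H]
    surjective. *)
Lemma simple_lgraph_iso G H (f : vertex G -> vertex H) :
    simple_lgraph G -> simple_lgraph H -> bijective f ->
    (forall e : edge G, exists e' : edge H,
       [/\ src e' = f (src e), tgt e' = f (tgt e) & lab e' = lab e]) ->
    (forall e' : edge H, exists e : edge G,
       [/\ src e' = f (src e), tgt e' = f (tgt e) & lab e' = lab e]) ->
  lgraph_iso G H.
Proof.
move=> sG sH bf /choice[g gP] gsurj; have injf := bij_inj bf.
exists f, g; split=> //; try by move=> e; have [] := gP e.
rewrite -setTT_bijective; split=> //.
  move=> e e' _ _ gee'; have [s t l] := gP e; have [s' t' l'] := gP e'.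
  apply: sG; last by apply: injf; rewrite -t -t' gee'.
    by apply: injf; rewrite -s -s' gee'.
  by rewrite -l -l' gee'.
move=> e' _; have [e [s' t' l']] := gsurj e'; have [s t l] := gP e.
by exists e => //; apply: sH; congruence.
Qed.

Variables (T : Type) (Q : set T) (E : T -> A -> T -> Prop).

Lemma rel_lgraph_simple : simple_lgraph (rel_lgraph Q E).
Proof.
move=> [[[P a] P'] ?] [[[R b] R'] ?] /= *.
by apply: val_inj => /=; congruence.
Qed.

Lemma rel_lgraphE (e : edge (rel_lgraph Q E)) :
  E (val (src e)) (lab e) (val (tgt e)).
Proof. exact: set_valP e. Qed.

Lemma rel_lgraph_edge (P P' : vertex (rel_lgraph Q E)) a :
    E (val P) a (val P') ->
  exists e : edge (rel_lgraph Q E), [/\ src e = P, tgt e = P' & lab e = a].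
Proof.
move=> EP; pose D := [set e : Q * A * Q | E (val e.1.1) e.1.2 (val e.2)].
by exists (SigSub (mem_set (EP : D (P, a, P')))).
Qed.

End Graphs.

(** * A criterion for being a foundation of the past set cover *)

Section Foundation.
Variables (A : finType) (X : set (int -> A)) (G : lgraph A).
(** Stands for the inclusion of the vertices among the Krieger vertices; the hypotheses collect what
    both covers share. *)
Variable past : vertex G -> set (nat -> A).
Hypothesis sX : sofic X.
Hypothesis past_inj : injective past.
Hypothesis past_krieger : forall v, krieger_vertices X (past v).
Hypothesis resG : left_resolving G.
Hypothesis past_src : forall e : edge G,
  past (src e) = ray_pre (lab e) (past (tgt e)).
Hypothesis past_edge : forall v a, ray_pre a (past v) !=set0 ->
  exists e : edge G, tgt e = v /\ lab e = a.
Hypothesis past_generate : forall w,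
  pred_word X w = \bigcup_(v in [set v | past v `<=` pred_word X w]) past v.

Let shX : shift_space X. Proof. by case: sX. Qed.
Let invX : @shift_map A @` X = X. Proof. by case: shX. Qed.

(** Closedness gives the first inclusion; for the converse a path is built backwards from [v], with
    edges from [past_edge]. *)
Lemma graph_pred_past v : graph_pred v = past v.
Proof.
apply/seteqP; split=> y.
  move=> [p [p0 pP]]; have [z _ zv] := past_krieger v.
  (* The vertex [n] edges before the end of the path; its nonempty past supplies rays agreeing with
     [y] on the last [n] letters. *)
  pose u n := if n is m.+1 then src (p m) else v.
  have tgtp n : tgt (p n) = u n by case: n => //= n; have [] := pP n.
  have step n y' : past (u n) y' -> past v (ray_cat (mkseq y n) y').
    elim: n y' => [//|n IHn] y'; rewrite ray_cat_mkseqS => uy'; apply: IHn.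
    by move: uy'; rewrite /= past_src tgtp; have [_ ->] := pP n.
  rewrite -zv; apply: pred_ray_limit => // n; rewrite zv.
  by have [y' /step ?] := krieger_vertices_neq0 (past_krieger (u n)); exists y'.
move=> vy.
(* [e0] is a mere default for the choice function [f] where [ray_pre va.2 (past va.1)] is empty. *)
have [e0 _] : exists e : edge G, tgt e = v /\ lab e = y 0%N.
  apply: past_edge; exists (fun n => y n.+1); rewrite /ray_pre /=.
  by rewrite (_ : ray_cons _ _ = y)//; apply/funext => -[].
have /choice[f fP] (va : vertex G * A) : exists e : edge G,
    ray_pre va.2 (past va.1) !=set0 -> tgt e = va.1 /\ lab e = va.2.
  have [/past_edge[e ?]|] := pselect (ray_pre va.2 (past va.1) !=set0).
    by exists e.
  by exists e0.
pose u := fix u n := if n is m.+1 then src (f (u m, y m)) else v.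
have consE n : ray_cons (y n) (fun k => y (n.+1 + k)%N) = fun k => y (n + k)%N.
  by apply/funext => -[|k] /=; rewrite ?addn0// addSnnS.
have fu n : past (u n) (fun k => y (n + k)%N) ->
    tgt (f (u n, y n)) = u n /\ lab (f (u n, y n)) = y n.
  move=> uy; apply: (fP (_, _)); exists (fun k => y (n.+1 + k)%N).
  by rewrite /ray_pre /= consE.
(* The rest of [y] stays a past of the current vertex, so [f] returns a genuine edge at each
   stage. *)
have uy n : past (u n) (fun k => y (n + k)%N).
  elim: n => [//|n IHn] /=; have [tn ln] := fu _ IHn.
  by rewrite past_src tn ln /ray_pre /= consE.
exists (fun n => f (u n, y n)); split=> [|n]; first by have [] := fu _ (uy 0%N).
by have [] := fu _ (uy n.+1); have [] := fu _ (uy n).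
Qed.

(** An edge of a left-resolving graph is recovered from its target and label. *)
Lemma finite_past_lgraph : finite_lgraph G.
Proof.
have finV : finite_set [set: vertex G].
  rewrite (_ : setT = past @^-1` krieger_vertices X); last first.
    by apply/seteqP; split=> v // _; apply: past_krieger.
  apply: finite_preimage; last exact: finite_krieger_vertices.
  by move=> u v _ _; apply: past_inj.
split=> //; pose g (e : edge G) := (tgt e, lab e).
rewrite (_ : setT = g @^-1` ([set: vertex G] `*` [set: A])); last first.
  by apply/seteqP; split=> e.
apply: finite_preimage; last exact: finite_setX.
by move=> e e' _ _ [? ?]; apply: resG.
Qed.

Lemma past_separated : predecessor_separated G.
Proof. by move=> u v uv; rewrite !graph_pred_past => /past_inj. Qed.

Let union (V : set (vertex G)) := \bigcup_(v in V) past v.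

(** [past_edge] supplies the edges for the second inclusion. As the right side depends on [union V]
    alone, equality of unions survives taking predecessors. *)
Let union_pre a V : union (word_pre [:: a] V) = ray_pre a (union V).
Proof.
apply/seteqP; split=> [y [u /word_pre1[e [<- <- Ve]]]|y [v Vv vy]].
  by rewrite past_src; exists (tgt e).
have [|e [ev ea]] := @past_edge v a; first by exists y.
exists (src e); first by apply/word_pre1; exists e; rewrite ev.
by rewrite past_src ev ea.
Qed.

Let union_neq0 V : union V !=set0 <-> V !=set0.
Proof.
split=> [[y [v ? _]]|[v Vv]]; first by exists v.
by have [y ?] := krieger_vertices_neq0 (past_krieger v); exists y; exists v.
Qed.

Let S : set (set (vertex G)) :=
  [set V | exists2 w, language X w & union V = pred_word X w].
Let R (U V : set (vertex G)) := union U = union V.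

Let S_pre a w V : union V = pred_word X w -> word_pre [:: a] V !=set0 ->
  language X (a :: w) /\ union (word_pre [:: a] V) = pred_word X (a :: w).
Proof.
move=> Vw /union_neq0; rewrite union_pre Vw -pred_word_cons// => aw.
by split=> //; apply/languageP.
Qed.

Let past_closed_union : past_closed S R.
Proof.
split; first by split=> [U _|U V _ _|U V W _ _ _]; rewrite /R => // -> //.
split=> [v|u v|V a [w _ Vw] aV|U V a _ _ UV].
- have [w Xw vw] := krieger_pred_word sX (past_krieger v).
  by exists w => //; rewrite /union bigcup_set1.
- by rewrite /R /union !bigcup_set1 => /past_inj.
- by have [? ?] := S_pre Vw aV; exists (a :: w).
- move=> /union_neq0; rewrite /R !union_pre UV -union_pre.
  by move=> /union_neq0.
Qed.

Let eq_class_union U V : S U -> S V ->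
  eq_class S R U = eq_class S R V <-> union U = union V.
Proof.
move=> SU SV; split=> [UV|UV].
  have : eq_class S R U V by rewrite UV.
  by case.
apply/seteqP; split=> W [SW]; rewrite /R => ?; split=> //.
  by rewrite /R -UV.
by rewrite /R UV.
Qed.

Lemma foundation_past_set_cover : foundation G (past_set_cover X).
Proof.
split; [exact: finite_past_lgraph|exact: resG|exact: past_separated|].
exists S, R; split; first exact: past_closed_union.
(* When [P] is a vertex of the past set cover, this is the largest family with union [P], hence a
   canonical representative of its class. *)
pose below (P : set (nat -> A)) := [set v | past v `<=` P].
have union_below w : union (below (pred_word X w)) = pred_word X w.
  by rewrite [RHS]past_generate.
have S_below (P : vertex (past_set_cover X)) : S (below (val P)).
  by have [w Xw <-] := set_valP P; exists w.
have union_val (P : vertex (past_set_cover X)) : union (below (val P)) = val P.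
  by have [w Xw <-] := set_valP P.
pose f (P : vertex (past_set_cover X)) : vertex (past_lgraph S R) :=
  SigSub (mem_set (imageP (eq_class S R) (S_below P))).
apply: (@simple_lgraph_iso _ _ _ f).
- exact: rel_lgraph_simple.
- exact: rel_lgraph_simple.
- rewrite -setTT_bijective; split=> //.
    move=> P P' _ _ /(congr1 val) /= /eq_class_union.
    move=> /(_ (S_below P) (S_below P')); rewrite !union_val; exact: val_inj.
  (* The word that puts [V] in [S] gives the preimage of its class. *)
  move=> C _; have [V [w Xw Vw] VC] := set_valP C.
  exists (SigSub (mem_set (imageP (pred_word X) Xw))) => //.
  apply: val_inj; rewrite -VC /=; apply/eq_class_union => //.
  + by exists w.
  + by exists w.
  + by rewrite union_below.
- move=> e; have [w [Xw Xaw es et]] := rel_lgraphE e.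
  have Vw : union (below (val (tgt e))) = pred_word X w by rewrite union_val.
  have ne : word_pre [:: lab e] (below (val (tgt e))) !=set0.
    apply/union_neq0; rewrite union_pre Vw -pred_word_cons//.
    exact/languageP.
  have [_ aVw] := S_pre Vw ne.
  apply: rel_lgraph_edge; exists (below (val (tgt e))); split=> //.
  apply/eq_class_union => //; first by exists (lab e :: w).
  by rewrite union_val es.
(* The word [w] attached to [V] names the target, and nonemptiness of the predecessors of [V] puts
   [lab e :: w] in the language. *)
- move=> e; have [V [[w Xw Vw] ne es et]] := rel_lgraphE e.
  have [Xaw aVw] := S_pre Vw ne.
  pose vtx w' (Xw' : language X w') : vertex (past_set_cover X) :=
    SigSub (mem_set (imageP (pred_word X) Xw')).
  have [|e' [s' t' l']] :=
      @rel_lgraph_edge _ _ _ _ (vtx _ Xaw) (vtx _ Xw) (lab e).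
    by exists w.
  exists e'; split=> //.
  + apply: val_inj; rewrite es s' /=; apply/eq_class_union => //.
    * by exists (lab e :: w).
    * by exists (lab e :: w).
    * by rewrite union_below.
  + apply: val_inj; rewrite et t' /=; apply/eq_class_union => //.
    * by exists w.
    * by exists w.
    * by rewrite union_below.
Qed.

End Foundation.

(** * The two covers meet the criterion *)

Section Covers.
Variables (A : finType) (X : set (int -> A)).
Hypothesis sX : sofic X.

Let invX : @shift_map A @` X = X. Proof. by case: sX => -[]. Qed.

Let K := left_krieger_cover X.

Lemma krieger_cover_src (e : edge K) :
  val (src e) = ray_pre (lab e) (val (tgt e)).
Proof.
by have [z [_ -> ->]] := rel_lgraphE e; rewrite pred_ray_cons.
Qed.

Lemma krieger_cover_left_resolving : left_resolving K.
Proof.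
move=> e e' t l; apply: rel_lgraph_simple => //.
by apply: val_inj; rewrite !krieger_cover_src t l.
Qed.

Lemma krieger_cover_edge (P : vertex K) a : ray_pre a (val P) !=set0 ->
  exists e : edge K, tgt e = P /\ lab e = a.
Proof.
have [z Xz zP] := set_valP P; rewrite -zP -pred_ray_cons// => Xaz.
(* [Xaz], nonemptiness of a past, is also membership of [ray_cons a z] in [right_rays X]. *)
pose Q : vertex K := SigSub (mem_set (imageP (pred_ray X) Xaz)).
have [|e [_ t l]] := @rel_lgraph_edge _ _ _ _ Q P a; last by exists e.
by exists z.
Qed.

Lemma left_krieger_cover_foundation :
  foundation (left_krieger_cover X) (past_set_cover X).
Proof.
apply: (@foundation_past_set_cover _ _ K (fun P => val P)) => //.
- by move=> P; apply: set_valP.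
- exact: krieger_cover_left_resolving.
- exact: krieger_cover_src.
- exact: krieger_cover_edge.
- move=> w; rewrite [LHS]pred_word_krieger; apply/seteqP; split=> y.
    move=> [P [KP Pw] Py]; exists (SigSub (mem_set KP)) => //.
  move=> [P Pw Py]; exists (val P) => //; split=> //; exact: set_valP.
Qed.

Let above_indecomposable (P : vertex K) :=
  exists2 P' : vertex K, indecomposable P' & exists p, is_path P p P'.

(** A decomposable [P] is a union of vertices other than [P], hence properly included in it and
    covered by induction over the finite set of vertices. *)
Lemma krieger_indecomposables P : krieger_vertices X P ->
  P `<=` \bigcup_(Q in [set Q : vertex K | indecomposable Q /\ val Q `<=` P])
           val Q.
Proof.
move: P; apply: finite_set_proper_ind; first exact: finite_krieger_vertices.
move=> P KP IH.
have [indP|] := pselect (indecomposable (SigSub (mem_set KP) : vertex K)).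
  by move=> y Py; exists (SigSub (mem_set KP)) => //; split.
move=> /existsNP[V /not_implyP[VK /not_implyP[/= PV nVP]]] y.
rewrite [in X in X -> _]PV => -[Q VQ Qy].
have QP : Q `<=` P by rewrite PV => ? ?; exists Q.
have [|Q' [indQ' Q'Q] Q'y] := IH Q (VK _ VQ) _ y Qy.
  split=> // PQ; apply: nVP; rewrite (_ : P = Q)//.
  by apply/seteqP; split.
by exists Q' => //; split=> //; apply: subset_trans QP.
Qed.

Lemma generalised_left_fischer_cover_foundation :
  foundation (generalised_left_fischer_cover X) (past_set_cover X).
Proof.
apply: (@foundation_past_set_cover _ _ (generalised_left_fischer_cover X)
  (fun P => val (val P))) => //.
- by move=> P Q /val_inj/val_inj.
- by move=> P; apply: set_valP.
- move=> e e' /(congr1 val) /= t l; apply: val_inj.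
  exact: krieger_cover_left_resolving t l.
- by move=> e; apply: krieger_cover_src.
- move=> P a /krieger_cover_edge[e [t l]].
  have DP : above_indecomposable (tgt e) by rewrite t; apply: set_valP.
  (* Prepending [e] to a path from its target keeps the source in the subgraph, so no incoming edge
     is lost. *)
  have De : above_indecomposable (src e).
    by have [Q indQ [p eQ]] := DP; exists Q => //; exists (e :: p).
  exists (SigSub (mem_set (conj De DP : [set e : edge K |
    above_indecomposable (src e) /\ above_indecomposable (tgt e)] e))).
  by split=> //; apply: val_inj.
- move=> w; apply/seteqP; split=> y; last by move=> [P Pw]; apply: Pw.
  rewrite {1}pred_word_krieger => -[P [KP Pw]].
  move=> /(krieger_indecomposables KP)[Q [indQ QP] Qy].
  have DQ : above_indecomposable Q by exists Q => //; exists [::].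
  by exists (SigSub (mem_set DQ)) => //=; apply: subset_trans Pw.
Qed.

End Covers.

Theorem theorem3p22 (A : finType) (X : set (int -> A)) (hX : sofic X) :
  foundation (generalised_left_fischer_cover X) (past_set_cover X) /\
  foundation (left_krieger_cover X) (past_set_cover X).
Proof.
split; first exact: generalised_left_fischer_cover_foundation.
exact: left_krieger_cover_foundation.
Qed.
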